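(* The set $-\imath\,\Psi_{\mathbf{L},\mathbf{K}}\big(\mathbb{P}(W_{\mathbf{L},\mathbf{K}})\big)\subset\mathbb{R}^2$ is the convex hull of the collection of the points $\begin{pmatrix}k_a+l_a&l_a\end{pmatrix}^t$ and $\begin{pmatrix}l_a&k_a+l_a\end{pmatrix}^t$, $a=1,\ldots,r$, or equivalently of the segments $J_{k_a,l_a}$, $a=1,\ldots,r$.
   Context: $T\le G=U(2)$ is the torus of diagonal unitary matrices, and its Lie algebra $\mathfrak{t}$ (diagonal skew-Hermitian matrices) is identified with $\imath\,\mathbb{R}^2$ by taking diagonal entries. Let $r\ge 1$, $\mathbf{L}=(l_a)\in\mathbb{Z}^r$, $\mathbf{K}=(k_a)\in\mathbb{N}^r$, and $W_{\mathbf{L},\mathbf{K}}=\bigoplus_{a=1}^r\det^{\otimes l_a}\otimes\mathrm{Sym}^{k_a}(\mathbb{C}^2)\cong\bigoplus_{a=1}^r\mathbb{C}^{k_a+1}$ (composed with $B\mapsto(B^t)^{-1}$). Write $Z=(Z_a)_{a=1}^r$ with $Z_a=(z_{a,0},\ldots,z_{a,k_a})^t$. The moment map (with respect to twice the Fubini-Study form) of the induced $T$-action on $\mathbb{P}(W_{\mathbf{L},\mathbf{K}})$ is $\Psi_{\mathbf{L},\mathbf{K}}:\mathbb{P}(W_{\mathbf{L},\mathbf{K}})\to\mathfrak{t}\cong\imath\,\mathbb{R}^2$, $$\Psi_{\mathbf{L},\mathbf{K}}([Z])=\frac{\imath}{\|Z\|^2}\sum_{a=1}^r\sum_{j=0}^{k_a}|z_{a,j}|^2\begin{pmatrix}k_a-j+l_a\\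 j+l_a\end{pmatrix}.$$ $J_{k,l}\subset\mathbb{R}^2$ denotes the segment joining $\begin{pmatrix}k+l&l\end{pmatrix}^t$ and $\begin{pmatrix}l&k+l\end{pmatrix}^t$. *)

(* Defs.v *)
From HB Require Import structures.
From mathcomp Require Import all_boot all_order all_algebra.
From mathcomp Require Import generic_quotient.
From mathcomp Require Import boolp classical_sets reals convex.
From mathcomp Require Import complex.

Set Implicit Arguments.
Unset Strict Implicit.
Unset Printing Implicit Defensive.

Import Order.TTheory GRing.Theory Num.Theory.

Local Open Scope quotient_scope.
Local Open Scope classical_set_scope.
Local Open Scope ring_scope.

Section ProjectiveSpace.
Variables (F : fieldType) (n : nat).

Definition nonzero_cvec : Type := {Z : 'cV[F]_n | Z != 0}.
HB.instance Definition _ := SubChoice.on nonzero_cvec.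

Definition proportional (Z Z' : nonzero_cvec) : bool :=
  `[< exists2 c : F, c != 0 & val Z = c *: val Z' >].

Lemma proportional_refl : reflexive proportional.
Proof. by move=> Z; apply/asboolP; exists 1; rewrite ?oner_neq0 ?scale1r. Qed.

Lemma proportional_sym : symmetric proportional.
Proof.
suff sub Z Z' : proportional Z Z' -> proportional Z' Z.
  by move=> Z Z'; apply/idP/idP; apply: sub.
move/asboolP=> [c c0 e]; apply/asboolP; exists c^-1; first by rewrite invr_eq0.
by rewrite e scalerA mulVf ?scale1r.
Qed.

Lemma proportional_trans : transitive proportional.
Proof.
move=> Z2 Z1 Z3 /asboolP[c c0 e] /asboolP[d d0 e']; apply/asboolP.
by exists (c * d); rewrite ?mulf_neq0 // e e' scalerA.
Qed.

Canonical proportional_equiv :=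
  EquivRel proportional proportional_refl proportional_sym proportional_trans.

Definition projective_space : Type := {eq_quot proportional}.
HB.instance Definition _ := Choice.on projective_space.
HB.instance Definition _ := EqQuotient.on projective_space.

End ProjectiveSpace.

Section Convexity.
Variables (R : realType) (V : lmodType R).

Definition convex_hull (A : set V) : set V := smallest (@convex_set R V) A.

Definition segment (x y : V) : set V :=
  [set z | exists2 t : R, 0 <= t <= 1 & z = (1 - t) *: x + t *: y].

End Convexity.

Definition vec2 (S : Type) (x y : S) : 'cV[S]_2 :=
  \col_i (if i == 0 then x else y).

Section MomentMap.
Variables (R : realType) (r : nat) (L : 'I_r -> int) (K : 'I_r -> nat).

(* Column vectors of height \sum_a (K a).+1 are block columns; the block
   [submxcol Z a] is the component Z_a in C^{k_a + 1}. *)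
Definition W_dim : nat := (\sum_(a < r) (K a).+1)%N.

Definition PW : Type := projective_space R[i] W_dim.

(* Hermitian norm; the norm on matrices provided by the library is the
   sup norm. *)
Definition sqnorm (n : nat) (Z : 'cV[R[i]]_n) : R[i] :=
  \sum_(i < n) `|Z i 0| ^+ 2.

Definition weight (a : 'I_r) (j : 'I_(K a).+1) : 'cV[R[i]]_2 :=
  vec2 ((K a)%:R - j%:R + (L a)%:~R) (j%:R + (L a)%:~R).

Definition Psi_vec (Z : 'cV[R[i]]_W_dim) : 'cV[R[i]]_2 :=
  ('i%C / sqnorm Z) *:
    \sum_(a < r) \sum_(j < (K a).+1) `|submxcol Z a j 0| ^+ 2 *: weight j.

Definition Psi (p : PW) : 'cV[R[i]]_2 := Psi_vec (val (repr p)).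

Lemma sqnormZ (n : nat) (c : R[i]) (Z : 'cV[R[i]]_n) :
  sqnorm (c *: Z) = `|c| ^+ 2 * sqnorm Z.
Proof.
by rewrite /sqnorm mulr_sumr; apply: eq_bigr => i _; rewrite mxE normrM exprMn.
Qed.

Lemma Psi_vecZ (c : R[i]) (Z : 'cV[R[i]]_W_dim) :
  c != 0 -> Psi_vec (c *: Z) = Psi_vec Z.
Proof.
move=> c0; have n0 : `|c| ^+ 2 != 0 by rewrite expf_neq0 ?normr_eq0.
rewrite /Psi_vec sqnormZ.
under eq_bigr do under eq_bigr do rewrite !mxE normrM exprMn -scalerA.
under eq_bigr do rewrite -scaler_sumr.
rewrite -scaler_sumr scalerA invfM -mulrA (mulrAC _^-1) mulVf // mul1r.
congr (_ *: _).
by apply: eq_bigr => a _; apply: eq_bigr => j _; rewrite mxE.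
Qed.

(* [Psi] can be computed from any homogeneous coordinates. *)
Lemma PsiE (Z : nonzero_cvec R[i] W_dim) :
  Psi (\pi_PW Z) = Psi_vec (val Z).
Proof.
rewrite /Psi; have /eqmodP/asboolP[c c0 ->] : repr (\pi_PW Z) = Z %[mod PW].
  by rewrite reprK.
exact: Psi_vecZ.
Qed.

End MomentMap.

Section Segments.
Variables (R : realType) (k : nat) (l : int).

Definition vertex1 : 'cV[R]_2 := vec2 (k%:R + l%:~R) l%:~R.

Definition vertex2 : 'cV[R]_2 := vec2 l%:~R (k%:R + l%:~R).

Definition J : set 'cV[R]_2 := segment vertex1 vertex2.

End Segments.

Arguments vertex1 : clear implicits.
Arguments vertex2 : clear implicits.
Arguments J : clear implicits.

(* The standard inclusion of R^2 in C^2. *)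
Definition R2_in_C2 (R : realType) (v : 'cV[R]_2) : 'cV[R[i]]_2 :=
  map_mx (real_complex R) v.

(* Main.v *)
(* The weights of the torus on the block [a] are equally spaced on the segment
   [J R (K a) (L a)], both endpoints included.  The quantities |z_{a,j}|^2 / |Z|^2
   form an arbitrary point of the standard simplex, so that the image of the
   moment map is the set of all barycenters of the weights, i.e. their convex
   hull; the weights, the endpoints and the segments have the same hull. *)
Require Import Defs.
From mathcomp Require Import all_boot all_order all_algebra.
From mathcomp Require Import boolp classical_sets reals convex.
From mathcomp Require Import complex.
From mathcomp Require Import interval_inference ring.

Import Order.TTheory GRing.Theory Num.Theory.

Local Open Scope quotient_scope.
Local Open Scope classical_set_scope.
Local Open Scope ring_scope.

(** * Convex hulls and finite barycenters *)

Section ConvexHull.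
Variables (R : realType) (V : lmodType R).
Implicit Types (A B : set V) (x y : V).

Lemma convex_setP A :
  convex_set A <->
  forall x y (t : R), 0 <= t <= 1 -> A x -> A y -> A (t *: x + (1 - t) *: y).
Proof.
split=> [cA x y t t01 Ax Ay | cA x y t].
  have := cA x y (Itv01 (andP t01).1 (andP t01).2) (mem_set Ax) (mem_set Ay).
  by move/set_mem.
rewrite !inE => Ax Ay; apply: cA => //.
by rewrite ge0 le1.
Qed.

(** Induction over the list of indices. Dividing each partial sum by its mass keeps it in [A], and
    adding one index is then a single two-point combination. *)
Lemma convex_sum A (I : finType) (p : I -> R) (f : I -> V) :
    convex_set A -> (forall i, 0 <= p i) -> \sum_i p i = 1 ->
    (forall i, A (f i)) ->
  A (\sum_i p i *: f i).
Proof.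
move=> /convex_setP cA p0 p1 Af.
have key (s : seq I) : 0 < \sum_(i <- s) p i ->
    A ((\sum_(i <- s) p i)^-1 *: \sum_(i <- s) p i *: f i).
  elim: s => [|i s IH]; first by rewrite big_nil ltxx.
  rewrite !big_cons; set S := \sum_(j <- s) p j in IH *.
  set T := \sum_(j <- s) p j *: f j in IH *.
  have S0 : 0 <= S by apply: sumr_ge0.
  move=> pS; have pSn : p i + S != 0 by rewrite gt_eqF.
  (* A tail of mass zero cannot be normalised, but then all its coefficients vanish and only [f i]
     remains. *)
  have [/eqP Sz|Sn] := eqVneq S 0.
    have -> : T = 0.
      rewrite /T; apply: big1_seq => j /andP[_ js].
      have := Sz; rewrite psumr_eq0 // => /allP /(_ j js) /eqP ->.
      by rewrite scale0r.
    move/eqP: Sz pSn => ->; rewrite !addr0 => pin.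
    by rewrite scalerA mulVf // scale1r.
  have -> : (p i + S)^-1 *: (p i *: f i + T) =
     (p i / (p i + S)) *: f i + (1 - p i / (p i + S)) *: (S^-1 *: T).
    rewrite scalerDr !scalerA mulrC; congr (_ + _ *: _).
    by field; rewrite Sn pSn.
  apply: cA => //; last by apply: IH; rewrite lt_def Sn S0.
  by rewrite divr_ge0 ?(ltW pS) //= ler_pdivrMr // mul1r lerDl.
by have := key (index_enum I); rewrite p1 invr1 scale1r; apply; exact: ltr01.
Qed.

Lemma sub_convex_hull A : A `<=` convex_hull A.
Proof. exact: sub_gen_smallest. Qed.

Lemma convex_hull_min A B : convex_set B -> A `<=` B -> convex_hull A `<=` B.
Proof. exact: smallest_sub. Qed.

Lemma convex_hull_convex A : convex_set (convex_hull A).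
Proof.
apply/convex_setP => x y t t01 hx hy B [cB AB].
by move/convex_setP: (cB); apply => //; [apply: hx | apply: hy].
Qed.

Lemma convex_hullS A B :
  A `<=` convex_hull B -> convex_hull A `<=` convex_hull B.
Proof. by apply: convex_hull_min; exact: convex_hull_convex. Qed.

(** The barycenters form a convex set containing every [f i], so they contain the hull; the converse
    is [convex_sum]. *)
Lemma convex_hull_range (I : finType) (f : I -> V) :
  convex_hull (range f) =
  [set \sum_i p i *: f i |
     p in [set p : I -> R | (forall i, 0 <= p i) /\ \sum_i p i = 1]].
Proof.
apply/seteqP; split.
  apply: convex_hull_min.
    apply/convex_setP => _ _ t /andP[t0 t1] [p [p0 p1] <-] [q [q0 q1] <-].
    exists (fun i => t * p i + (1 - t) * q i).
      split=> [i|]; first by rewrite addr_ge0 // mulr_ge0 // subr_ge0.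
      by rewrite big_split /= -!mulr_sumr p1 q1 !mulr1 subrKC.
    rewrite !scaler_sumr -big_split /=; apply: eq_bigr => i _.
    by rewrite scalerDl !scalerA.
  (* The point [f i] is the barycenter for the Dirac mass at [i]. *)
  move=> _ [i _ <-]; exists (fun j => (j == i)%:R).
    split=> [j|]; first by rewrite ler0n.
    rewrite (bigD1 i) //= eqxx big1 ?addr0 // => j /negPf -> //.
  rewrite (bigD1 i) //= eqxx scale1r big1 ?addr0 // => j /negPf ->.
  by rewrite scale0r.
move=> _ [p [p0 p1] <-]; apply: convex_sum => //.
  exact: convex_hull_convex.
by move=> i; apply: sub_convex_hull; exists i.
Qed.

Lemma segment_convex_hull A x y :
  A x -> A y -> segment x y `<=` convex_hull A.
Proof.
move=> Ax Ay _ [t /andP[t0 t1] ->].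
have /convex_setP cA := convex_hull_convex A.
(* [segment] puts its parameter on the second point, [convex_setP] on the first, hence the use of
   [1 - t]. *)
have -> : t *: y = (1 - (1 - t)) *: y by rewrite subKr.
by apply: cA; [rewrite subr_ge0 t1 gerBl | exact: sub_convex_hull..].
Qed.

End ConvexHull.

Lemma eq_cV2 (S : Type) (u v : 'cV[S]_2) :
  u 0 0 = v 0 0 -> u 1 0 = v 1 0 -> u = v.
Proof.
move=> e0 e1; apply/matrixP => i j; rewrite (ord1 j).
by case: i => -[|[|//]] Hi; [move: e0|move: e1];
  congr (_ = _); congr (fun_of_matrix _ _ _); apply: val_inj.
Qed.

(** * The weights and the image of the moment map *)

Section Weights.
Variables (R : realType) (r : nat) (L : 'I_r -> int) (K : 'I_r -> nat).

Definition real_weight (a : 'I_r) (j : 'I_(K a).+1) : 'cV[R]_2 :=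
  vec2 ((K a)%:R - j%:R + (L a)%:~R) (j%:R + (L a)%:~R).

Lemma real_weight_J a j : J R (K a) (L a) (real_weight a j).
Proof.
(* For [K a = 0] the segment is a point; otherwise the weight sits at parameter [j / K a]. *)
have [K0|Kn] := eqVneq (K a) 0%N.
  exists 0; first by rewrite lexx ler01.
  have j0 : j = 0%N :> nat by apply/eqP; rewrite -leqn0 -ltnS -K0.
  rewrite subr0 scale1r scale0r addr0.
  by apply: eq_cV2; rewrite !mxE /= j0 ?K0 ?subr0 ?add0r.
have Kr : (K a)%:R != 0 :> R by rewrite pnatr_eq0.
exists (j%:R / (K a)%:R).
  rewrite divr_ge0 ?ler0n //= ler_pdivrMr ?ltr0n ?lt0n // mul1r ler_nat.
  by rewrite -ltnS.
by apply: eq_cV2; rewrite !mxE /=; field.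
Qed.

Lemma vertex1E a : vertex1 R (K a) (L a) = real_weight a ord0.
Proof. by apply: eq_cV2; rewrite !mxE /= ?subr0 ?add0r. Qed.

Lemma vertex2E a : vertex2 R (K a) (L a) = real_weight a ord_max.
Proof. by apply: eq_cV2; rewrite !mxE /= ?subrr ?add0r. Qed.

Notation coord := {a : 'I_r & 'I_(K a).+1}.

(** The norm of [R[i]] takes its values in [R[i]], whereas barycentric coefficients must lie in
    [R]. *)
Definition sqmod (z : R[i]) : R := complex.Re z ^+ 2 + complex.Im z ^+ 2.

Lemma sqmod_ge0 z : 0 <= sqmod z.
Proof. by rewrite addr_ge0 ?sqr_ge0. Qed.

Lemma sqmod_eq0 z : (sqmod z == 0) = (z == 0).
Proof.
by case: z => x y; rewrite paddr_eq0 ?sqr_ge0 //= !sqrf_eq0 eq_complex.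
Qed.

(** The norm is summed over flat indices and the moment map over blocks; [tagnat.rank] matches the
    two. *)
Lemma sum_blocks (V : nmodType) (F : 'I_(W_dim K) -> V) :
  \sum_i F i = \sum_(s : coord) F (tagnat.rank s).
Proof. by rewrite (reindex _ tagnat.rank_bij_on). Qed.

(** The factor [- 'i] cancels the ['i] of [Psi_vec], and everything left is real. The case [Z = 0]
    is covered, since the inverse of 0 is 0 on both sides. *)
Lemma Psi_vecE (Z : 'cV[R[i]]_(W_dim K)) :
  - 'i%C *: Psi_vec L Z =
  R2_in_C2 (\sum_(s : coord)
    (sqmod (Z (tagnat.rank s) 0) / \sum_i sqmod (Z i 0)) *:
    real_weight (tag s) (tagged s)).
Proof.
have sqE z : `|z| ^+ 2 = real_complex R (sqmod z) by rewrite -add_Re2_Im2.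
have -> : \sum_(s : coord)
    (sqmod (Z (tagnat.rank s) 0) / \sum_i sqmod (Z i 0)) *:
      real_weight (tag s) (tagged s) =
   (\sum_i sqmod (Z i 0))^-1 *: \sum_(s : coord)
      sqmod (Z (tagnat.rank s) 0) *: real_weight (tag s) (tagged s).
  by rewrite scaler_sumr; apply: eq_bigr => s _; rewrite scalerA mulrC.
rewrite /R2_in_C2 map_mxZ raddf_sum /= /Psi_vec scalerA; congr (_ *: _).
  rewrite mulNr mulrA -expr2 sqr_i mulN1r opprK fmorphV rmorph_sum.
  by congr _^-1; apply: eq_bigr => i _; rewrite sqE.
rewrite sig_big_dep; apply: eq_bigr => -[a j] _ /=.
rewrite map_mxZ mxE sqE; congr (_ *: _).
by apply: eq_cV2; rewrite !mxE /= rmorphD ?rmorphB ?rmorph_nat ?rmorph_int.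
Qed.

Lemma Psi_image :
  [set - 'i%C *: Psi L p | p in [set: PW R K]] =
  @R2_in_C2 R @`
    convex_hull (range (fun s : coord => real_weight (tag s) (tagged s))).
Proof.
rewrite convex_hull_range; apply/seteqP; split.
  move=> _ [P _ <-]; rewrite /Psi; set Z := repr P.
  (* A vanishing sum of nonnegative terms would force every entry of [Z] to be 0. *)
  have Zn0 : \sum_i sqmod (val Z i 0) != 0.
    apply: contra_neq (valP Z); move/eqP; rewrite psumr_eq0 => [/allP Z0|i _].
      apply/matrixP => i j; rewrite (ord1 j) mxE; apply/eqP.
      by rewrite -sqmod_eq0; apply: (Z0 i); rewrite mem_index_enum.
    exact: sqmod_ge0.
  rewrite Psi_vecE; eexists; last by [].
  exists (fun s : coord =>
    sqmod (val Z (tagnat.rank s) 0) / \sum_i sqmod (val Z i 0)) => //.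
  split=> [s|].
    by rewrite divr_ge0 ?sqmod_ge0 // sumr_ge0 // => i _; exact: sqmod_ge0.
  by rewrite -mulr_suml -(sum_blocks _ (fun i => sqmod (val Z i 0))) mulfV.
move=> _ [_ [p [p0 p1] <-] <-].
(* Square roots of the prescribed coefficients have squared moduli [p s]; their total is 1, so [Z]
   is nonzero and already normalised. *)
pose Z : 'cV[R[i]]_(W_dim K) :=
  \col_i (Num.sqrt (p (tagnat.sig i)))%:C%C.
have sqZ s : sqmod (Z (tagnat.rank s) 0) = p s.
  by rewrite mxE tagnat.rankK /sqmod /= expr0n addr0 sqr_sqrtr.
have sumZ : \sum_i sqmod (Z i 0) = 1.
  by rewrite sum_blocks -[RHS]p1; apply: eq_bigr => s _.
have Z0 : Z != 0.
  apply/eqP => Z0; move: sumZ; rewrite Z0 big1 => [/esym/eqP|i _].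
    by rewrite oner_eq0.
  by apply/eqP; rewrite sqmod_eq0 mxE.
exists (\pi_(PW R K) (exist _ Z Z0)) => //.
rewrite PsiE /= Psi_vecE sumZ; congr R2_in_C2; apply: eq_bigr => s _.
by rewrite sqZ divr1.
Qed.

(** The vertices are the weights for [j = 0] and [j = K a]; conversely, each weight lies on the
    segment between the vertices of its block. *)
Lemma convex_hull_vertices :
  convex_hull (\bigcup_(a in [set: 'I_r])
                 [set vertex1 R (K a) (L a); vertex2 R (K a) (L a)]) =
  convex_hull (range (fun s : coord => real_weight (tag s) (tagged s))).
Proof.
apply/seteqP; split; apply: convex_hullS.
  move=> _ [a _ [->|->]]; apply: sub_convex_hull; rewrite ?vertex1E ?vertex2E.
    by exists (existT (fun b => 'I_(K b).+1) a ord0).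
  by exists (existT (fun b => 'I_(K b).+1) a ord_max).
move=> _ [s _ <-]; apply: segment_convex_hull (real_weight_J _ _).
  by exists (tag s) => //; left.
by exists (tag s) => //; right.
Qed.

Lemma convex_hull_segments :
  convex_hull (\bigcup_(a in [set: 'I_r])
                 [set vertex1 R (K a) (L a); vertex2 R (K a) (L a)]) =
  convex_hull (\bigcup_(a in [set: 'I_r]) J R (K a) (L a)).
Proof.
apply/seteqP; split; apply: convex_hullS; last first.
  move=> v [a _ Jv]; apply: segment_convex_hull Jv.
    by exists a => //; left.
  by exists a => //; right.
move=> _ [a _ [->|->]]; apply: sub_convex_hull; exists a => //.
  by rewrite vertex1E; exact: real_weight_J.
by rewrite vertex2E; exact: real_weight_J.
Qed.

End Weights.

Theorem corollary2p8 (R : realType) (r : nat) (hr : (0 < r)%N)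
    (L : 'I_r -> int) (K : 'I_r -> nat) :
  [set (- 'i%C) *: Psi L p | p in [set: PW R K]] =
    @R2_in_C2 R @`
      convex_hull (\bigcup_(a in [set: 'I_r])
                     [set vertex1 R (K a) (L a); vertex2 R (K a) (L a)]) /\
  [set (- 'i%C) *: Psi L p | p in [set: PW R K]] =
    @R2_in_C2 R @`
      convex_hull (\bigcup_(a in [set: 'I_r]) J R (K a) (L a)).
Proof. by rewrite -convex_hull_segments convex_hull_vertices Psi_image. Qed.
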